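(* Let $d\ge 2$. All functions $f:[-1,1]\to\mathbb{R}$ that are even on $[-1,1]$ and given by the expansion $$f(\cos\theta)=\sum_{n=0}^\infty a_{2n}C_{2n}^{\frac{d-1}{2}}(\cos\theta),\qquad a_{2n}\ge 0\quad\text{for all } n\in\mathbb{N}_0,$$ are in $\Phi(\mathbb{T}^d)$. Moreover, such an $f$ is in $\mathrm{S}\Phi(\mathbb{T}^d)$ if and only if there are infinitely many positive $a_{2n}$.
   Context: $\mathbb{T}^d=\{x\in\mathbb{R}^d: x_1\ge0,\ldots,x_d\ge0,\ |x|\le1\}$ is the simplex, where $|x|=x_1+\cdots+x_d$, equipped with the distance $$\mathsf{d}_{\mathbb{T}}(x,y)=\arccos\left(\langle\sqrt{x},\sqrt{y}\rangle+\sqrt{1-|x|}\sqrt{1-|y|}\right),\qquad \sqrt{x}:=(\sqrt{x_1},\ldots,\sqrt{x_d}).$$ Let $\Omega$ be a set with a distance function $\mathsf{d}_\Omega\le\pi$. A continuous function $f:[-1,1]\to\mathbb{R}$ is called positive definite (respectively, strictly positive definite) on $\Omega$ if for every $N\in\mathbb{N}$ and every set of $N$ distinct points $x_1,\ldots,x_N\in\Omega$ the $N\times N$ matrix $[f(\cos \mathsf{d}_\Omega(x_i,x_j))]_{i,j=1}^N$ is nonnegative definite (respectively, positive definite). $\Phi(\Omega)$ and $\mathrm{S}\Phi(\Omega)$ denote the sets of positive definite and strictly positive definite functions on $\Omega$. $C_n^\lambda$ is the Gegenbauer polynomial of degree $n$, orthogonal on $[-1,1]$ with respect to $(1-t^2)^{\lambda-1/2}$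 and normalized by $C_n^\lambda(1)=(2\lambda)_n/n!$. Expansions with nonnegative coefficients are understood to converge absolutely and uniformly to $f(\cos\theta)$ on $[0,\pi]$. *)

(* Defs.v *)
From HB Require Import structures.
From mathcomp Require Import all_boot all_order all_algebra.
From mathcomp Require Import all_classical all_reals all_analysis.

Set Implicit Arguments.
Unset Strict Implicit.
Unset Printing Implicit Defensive.

Import Order.TTheory GRing.Theory Num.Theory.
Import numFieldNormedType.Exports.

Local Open Scope classical_set_scope.
Local Open Scope ring_scope.

Definition coord_sum (R : realType) (d : nat) (x : 'rV[R]_d) : R :=
  \sum_(i < d) x ord0 i.

Definition simplex (R : realType) (d : nat) : set 'rV[R]_d :=
  [set x : 'rV[R]_d | (forall i, 0 <= x ord0 i) /\ coord_sum x <= 1].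

Definition simplex_dist (R : realType) (d : nat) (x y : 'rV[R]_d) : R :=
  acos (\sum_(i < d) Num.sqrt (x ord0 i) * Num.sqrt (y ord0 i)
        + Num.sqrt (1 - coord_sum x) * Num.sqrt (1 - coord_sum y)).

Definition nonneg_definite (R : realType) (N : nat) (A : 'M[R]_N) : Prop :=
  A^T = A /\ forall c : 'rV[R]_N, 0 <= (c *m A *m c^T) ord0 ord0.

Definition pos_definite (R : realType) (N : nat) (A : 'M[R]_N) : Prop :=
  A^T = A /\ forall c : 'rV[R]_N, c != 0 -> 0 < (c *m A *m c^T) ord0 ord0.

(* A function on [-1, 1] is represented by a total function R -> R of which
   only the values on [-1, 1] are constrained. *)
Definition dist_matrix (R : realType) (T : Type) (dist : T -> T -> R)
    (f : R -> R) (N : nat) (x : 'I_N -> T) : 'M[R]_N :=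
  \matrix_(i, j) f (cos (dist (x i) (x j))).

Definition Phi (R : realType) (T : Type) (Omega : set T)
    (dist : T -> T -> R) : set (R -> R) :=
  [set f : R -> R | {within `[-1, 1]%classic, continuous f} /\
    forall (N : nat) (x : 'I_N -> T), injective x ->
      (forall i, Omega (x i)) -> nonneg_definite (dist_matrix dist f x)].

Definition SPhi (R : realType) (T : Type) (Omega : set T)
    (dist : T -> T -> R) : set (R -> R) :=
  [set f : R -> R | {within `[-1, 1]%classic, continuous f} /\
    forall (N : nat) (x : 'I_N -> T), injective x ->
      (forall i, Omega (x i)) -> pos_definite (dist_matrix dist f x)].

Definition is_gegenbauer (R : realType) (lambda : R)
    (C : nat -> {poly R}) : Prop :=
  [/\ forall n, size (C n) = n.+1,
      forall m n, m != n ->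
        Rintegral lebesgue_measure `[-1, 1]%classic
          (fun t : R => (C m).[t] * (C n).[t]
                        * (1 - t ^+ 2) `^ (lambda - 2^-1)) = 0
    & forall n, (C n).[1] = (\prod_(i < n) (2 * lambda + i%:R)) / n`!%:R].

(* For lambda > 0 exactly one family satisfies is_gegenbauer, so the choice
   made by xget is irrelevant and the default value is never reached. *)
Definition gegenbauer (R : realType) (lambda : R) : nat -> {poly R} :=
  xget (fun=> 0) [set C | is_gegenbauer lambda C].

Definition even_gegenbauer_expansion (R : realType) (lambda : R)
    (a : nat -> R) (f : R -> R) : Prop :=
  let term (n : nat) (theta : R) : R :=
    a n.*2 * (gegenbauer lambda n.*2).[cos theta] in
  (forall theta, theta \in `[0, pi] ->
     cvgn [series `|term n theta| : R]_n) /\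
  {uniform `[0, pi]%classic,
     (fun (N : nat) (theta : R) => \sum_(0 <= n < N) term n theta) @ \oo
     --> (fun theta : R => f (cos theta))}.

(* Main.v *)
Require Import Defs.
From HB Require Import structures.
From mathcomp Require Import all_boot all_order all_algebra.
From mathcomp Require Import ring lra zify.
From mathcomp Require bigenough ssrcomplements mpoly.

(** The square-root map sends the simplex onto the part of the unit sphere of
    dimension [d] that lies in the closed positive orthant, and the distance of
    the simplex is the geodesic distance there ([simplex_distE]).  So the
    matrices in question are [f] applied to Gram matrices of unit vectors with
    nonnegative scalar products in dimension [d + 1].

    Nonnegativity is the easy half of Schoenberg's theorem: each Gegenbauer
    polynomial of parameter [(d - 1) / 2] is positive definite on the sphere.
    The proof is algebraic.  Homogenizing the three-term recurrence gives a
    polynomial [zonal] attached to each pole [y]; it is harmonic exactly because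
    the dimension is [2 * l + 2] ([laplacian_zonal]).  For the Fischer pairing,
    where multiplication by a variable is adjoint to its derivative, pairing
    with the zonal polynomial of pole [y] evaluates harmonic polynomials at [y]
    up to a positive constant ([fischer_zonal]).  Hence the Gegenbauer kernel is
    a Gram matrix ([geg_rec_posdef]), and limits of nonnegative combinations of
    such kernels are nonnegative.

    Suppose that infinitely many coefficients are positive and that a vector
    [c] annihilates the form.  Then it annihilates the form of each Gegenbauer
    kernel with positive coefficient, hence lies in the kernel of that
    matrix ([psd_null_row]).  Divided by the value at [1], the row of index [q]
    reads [c q] plus terms in which the polynomial is evaluated at scalar
    products in the half-open interval from [0] to [1]: distinct points of one
    orthant are never antipodal.  These terms tend to [0] along the even degrees
    ([gegpoly_even_decay], from the monotonicity of a Sonin energy of the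
    Gegenbauer differential equation), so [c q = 0].

    Conversely, if only finitely many coefficients are positive, [f] is a
    polynomial and its kernel on a great circle has finite rank, so it is
    degenerate on sufficiently many points ([finite_rank_kernel]).

    All this is proved for the family [gegpoly] given by the recurrence.  It is
    the orthogonal family of the definition ([gegenbauerE]): orthogonality is
    Green's identity for the differential equation, and an orthogonal family of
    polynomials of all degrees is determined by its values at [1]. *)

Set Implicit Arguments.
Unset Strict Implicit.
Unset Printing Implicit Defensive.

Import Order.TTheory GRing.Theory Num.Theory.

Local Open Scope ring_scope.

Lemma nat_two_step_ind (P : nat -> Prop) :
  P 0%N -> P 1%N -> (forall n, P n -> P n.+1 -> P n.+2) -> forall n, P n.
Proof.
move=> P0 P1 PS n; suff [] : P n /\ P n.+1 by [].
by elim: n => [|n [Pn Pn1]]; split=> //; apply: PS.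
Qed.

(** * The three-term recurrence of the Gegenbauer polynomials *)

Section Recurrence.
Variables (R : realFieldType) (l : R) (A : comNzRingType).
Variables (iota : {rmorphism R -> A}) (u v : A).

(** One recurrence serves three purposes. With [u = 'X] and [v = 1] it gives the
    Gegenbauer polynomials of parameter [l]; in the base field it gives their
    values; and with [u] the linear form of a vector [y] and [v] the square of
    the norm it gives their homogenization, which is the zonal harmonic of pole
    [y]. Scalars enter through a ring morphism, so that every consequence of the
    recurrence is an identity between ring expressions. *)
Fixpoint geg_rec_pair (n : nat) : A * A :=
  if n is m.+1 then
    let: (p, q) := geg_rec_pair m in
    (q, iota (m.+2%:R^-1)
        * (iota (2 * (m.+1%:R + l)) * (u * q) - iota (m%:R + 2 * l) * (v * p)))
  else (1, iota (2 * l) * u).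

Definition geg_rec (n : nat) : A := (geg_rec_pair n).1.

Lemma geg_rec0 : geg_rec 0 = 1. Proof. by []. Qed.
Lemma geg_rec1 : geg_rec 1 = iota (2 * l) * u. Proof. by []. Qed.

Lemma geg_recS2 n :
  n.+2%:R * geg_rec n.+2
  = iota (2 * (n.+1%:R + l)) * (u * geg_rec n.+1)
    - iota (n%:R + 2 * l) * (v * geg_rec n).
Proof.
rewrite /geg_rec /=; case: (geg_rec_pair n) => p q /=.
rewrite -[X in X * _](rmorph_nat iota) mulrA -rmorphM divff ?pnatr_eq0 //.
by rewrite rmorph1 mul1r.
Qed.

(** Used to clear the denominator [n.+2] of the recurrence. *)
Lemma mulr_natS_inj n : injective (fun x : A => n.+1%:R * x).
Proof.
move=> x y /= e; have := congr1 ( *%R (iota n.+1%:R^-1)) e.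
by rewrite -[X in X * x](rmorph_nat iota) -[X in X * y](rmorph_nat iota) !mulrA
  -!rmorphM mulVf ?pnatr_eq0 // rmorph1 !mul1r.
Qed.
End Recurrence.

(** This is what evaluates the polynomial and the zonal versions of the
    recurrence, and identifies their values. *)
Lemma rmorph_geg_rec (R : realFieldType) (l : R) (A B : comNzRingType)
    (iota : {rmorphism R -> A}) (iota' : {rmorphism R -> B})
    (phi : {rmorphism A -> B}) (u v : A) n :
  (forall c, phi (iota c) = iota' c) ->
  phi (geg_rec l iota u v n) = geg_rec l iota' (phi u) (phi v) n.
Proof.
move=> ic; elim/nat_two_step_ind: n => [||n IH0 IH1].
- by rewrite !geg_rec0 rmorph1.
- by rewrite !geg_rec1 rmorphM ic.
- apply: (@mulr_natS_inj _ _ iota' n.+1).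
  rewrite geg_recS2 -[X in X * phi _](rmorph_nat phi) -rmorphM geg_recS2.
  by rewrite rmorphB !rmorphM !ic IH0 IH1.
Qed.

(** * Zonal harmonics and positive definiteness on the sphere *)

Module SphericalHarmonics.
Import ssrcomplements mpoly bigenough BigEnough.
Local Open Scope ring_scope.

Section Fischer.
Variables (R : realFieldType) (D : nat).
Implicit Types (p q : {mpoly R[D]}) (i : 'I_D) (m : 'X_{1..D}).

Definition multi_fact m : R := (\prod_i (m i)`!)%:R.

Lemma multi_fact_gt0 m : 0 < multi_fact m.
Proof. by rewrite ltr0n prodn_gt0 // => i; rewrite fact_gt0. Qed.

Lemma multi_factS i m : multi_fact (m + U_(i))%MM = (m i).+1%:R * multi_fact m.
Proof.
rewrite /multi_fact -natrM (bigD1 i) //= [in RHS](bigD1 i) //=.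
rewrite mnmDE mnm1E eqxx addn1 factS mulnA; congr ((_ * _)%:R).
by apply: eq_bigr => j ji; rewrite mnmDE mnm1E eq_sym (negbTE ji) addn0.
Qed.

(** The Fischer (Bombieri) pairing, which makes multiplication by a variable
    adjoint to differentiation. The sum runs over the support of the second
    argument only, since the other terms vanish. *)
Definition fischer q p : R := \sum_(m <- msupp p) multi_fact m * q@_m * p@_m.

Lemma fischerwE q p k : (msize p <= k)%N ->
  fischer q p = \sum_(m : 'X_{1..D < k}) multi_fact m * q@_m * p@_m.
Proof.
move=> le_pk; set I : subFinType _ := 'X_{1..D < k}.
rewrite /fischer (big_mksub I) ?msupp_uniq //=; first last.
  by move=> x /msize_mdeg_lt /leq_trans; apply.
by rewrite big_rmcond //= => j /memN_msupp_eq0 ->; rewrite mulr0.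
Qed.

Lemma fischer_is_linear q : linear_for *%R (fischer q).
Proof.
move=> c p1 p2 /=; pose_big_enough k.
  rewrite !(@fischerwE _ _ k) // mulr_sumr -big_split; apply: eq_bigr => m _ /=.
  by rewrite mcoeffD mcoeffZ; ring.
by close.
Qed.

HB.instance Definition _ q :=
  GRing.isLinear.Build R {mpoly R[D]} R *%R (fischer q) (fischer_is_linear q).

Lemma fischerX q m : fischer q 'X_[m] = multi_fact m * q@_m.
Proof. by rewrite /fischer msuppX big_seq1 mcoeffX eqxx mulr1. Qed.

Lemma fischer_suml (c : 'I_D -> R) (q : 'I_D -> {mpoly R[D]}) p :
  fischer (\sum_i c i *: q i) p = \sum_i c i * fischer (q i) p.
Proof.
rewrite /fischer; under [RHS]eq_bigr do rewrite mulr_sumr.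
rewrite exchange_big; apply: eq_bigr => m _ /=.
rewrite raddf_sum mulr_sumr mulr_suml; apply: eq_bigr => i _ /=.
by rewrite mcoeffZ; ring.
Qed.

(** On monomials the factor [(m i).+1] produced by the derivative is the one
    that turns the factorial of [m] into that of [m + U_(i)]. *)
Lemma fischer_mulX i q p : fischer q ('X_i * p) = fischer q^`M(i) p.
Proof.
rewrite [p]mpolyE mulr_sumr !linear_sum; apply: eq_bigr => m _ /=.
rewrite -scalerAr !linearZ /= -mpolyXD [(_ + m)%MM]addmC !fischerX multi_factS.
by rewrite mcoeff_mderiv -mulr_natl; ring.
Qed.

Lemma fischer_ge0 p : 0 <= fischer p p.
Proof.
apply: sumr_ge0 => m _; rewrite -mulrA; apply: mulr_ge0; first exact/ltW/multi_fact_gt0.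
by rewrite -expr2 sqr_ge0.
Qed.

Definition linform (y : 'I_D -> R) : {mpoly R[D]} := \sum_i y i *: 'X_i.
Definition normsq : {mpoly R[D]} := \sum_i 'X_i ^+ 2.
Definition dderiv (y : 'I_D -> R) p := \sum_i y i *: p^`M(i).
(** The Euler operator: its eigenvectors for [n] are the homogeneous polynomials
    of degree [n], which expresses homogeneity without reference to supports. *)
Definition euler p := \sum_i 'X_i * p^`M(i).
Definition laplacian p := \sum_i p^`M(i)^`M(i).

Lemma mderivXU i j : ('X_j : {mpoly R[D]})^`M(i) = (i == j)%:R.
Proof.
rewrite mderivX mnm1E eq_sym; case: eqVneq => [->|_]; last by rewrite scale0r.
by rewrite scale1r -[X in (X - _)%MM]add0m addmK mpolyX0.
Qed.

Lemma mderiv_linform y i : (linform y)^`M(i) = (y i)%:MP.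
Proof.
rewrite /linform raddf_sum (bigD1 i) //= mderivZ mderivXU eqxx big1 ?addr0.
  by rewrite -mul_mpolyC mulr1.
by move=> j ji; rewrite mderivZ mderivXU eq_sym (negbTE ji) scaler0.
Qed.

Lemma mderiv_normsq i : normsq^`M(i) = 2%:R * 'X_i.
Proof.
rewrite /normsq raddf_sum (bigD1 i) //= expr2 mderivM mderivXU eqxx big1 ?addr0 /=.
  by rewrite mulr1n; ring.
by move=> j ji; rewrite mderivM mderivXU eq_sym (negbTE ji) mul0r mulr0 addr0.
Qed.

Lemma mderiv_sumE i (F : 'I_D -> {mpoly R[D]}) :
  (\sum_j F j)^`M(i) = \sum_j (F j)^`M(i).
Proof. exact: (raddf_sum (mderiv i)). Qed.

Lemma mderivCM i (c : R) p : (c%:MP * p)^`M(i) = c%:MP * p^`M(i).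
Proof. by rewrite mderivM mderivC mul0r add0r. Qed.

Lemma dderivM y p q : dderiv y (p * q) = dderiv y p * q + p * dderiv y q.
Proof.
rewrite /dderiv mulr_suml mulr_sumr -big_split; apply: eq_bigr => i _ /=.
by rewrite mderivM -!mul_mpolyC; ring.
Qed.

Lemma dderivC y c : dderiv y c%:MP = 0.
Proof. by apply: big1 => i _; rewrite mderivC scaler0. Qed.

Lemma dderivB y p q : dderiv y (p - q) = dderiv y p - dderiv y q.
Proof. by rewrite -sumrB; apply: eq_bigr => i _; rewrite mderivB scalerBr. Qed.

Lemma eulerM p q : euler (p * q) = euler p * q + p * euler q.
Proof.
rewrite /euler mulr_suml mulr_sumr -big_split; apply: eq_bigr => i _ /=.
by rewrite mderivM; ring.
Qed.

Lemma eulerC c : euler c%:MP = 0.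
Proof. by apply: big1 => i _; rewrite mderivC mulr0. Qed.

Lemma eulerB p q : euler (p - q) = euler p - euler q.
Proof. by rewrite -sumrB; apply: eq_bigr => i _; rewrite mderivB mulrBr. Qed.

Lemma laplacianM p q :
  laplacian (p * q) = laplacian p * q + 2%:R * (\sum_i p^`M(i) * q^`M(i)) + p * laplacian q.
Proof.
rewrite /laplacian mulr_suml !mulr_sumr -!big_split; apply: eq_bigr => i _ /=.
by rewrite !mderivM mderivD !mderivM; ring.
Qed.

Lemma laplacianC c : laplacian c%:MP = 0.
Proof. by apply: big1 => i _; rewrite mderivC mderiv0. Qed.

Lemma laplacianB p q : laplacian (p - q) = laplacian p - laplacian q.
Proof. by rewrite -sumrB; apply: eq_bigr => i _; rewrite !mderivB. Qed.

Lemma laplacianCM c p : laplacian (c%:MP * p) = c%:MP * laplacian p.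
Proof. by rewrite mulr_sumr; apply: eq_bigr => i _; rewrite !mderivCM. Qed.

Lemma euler_linform y : euler (linform y) = linform y.
Proof. by apply: eq_bigr => i _; rewrite mderiv_linform mulrC mul_mpolyC. Qed.

Lemma euler_normsq : euler normsq = 2%:R * normsq.
Proof. by rewrite mulr_sumr; apply: eq_bigr => i _; rewrite mderiv_normsq; ring. Qed.

Lemma dderiv_linform y : \sum_i y i ^+ 2 = 1 -> dderiv y (linform y) = 1.
Proof.
move=> y1; rewrite -[1](mpolyC1 D) -y1 raddf_sum; apply: eq_bigr => i _ /=.
by rewrite mderiv_linform -mul_mpolyC -rmorphM expr2.
Qed.

Lemma dderiv_normsq y : dderiv y normsq = 2%:R * linform y.
Proof.
by rewrite mulr_sumr; apply: eq_bigr => i _; rewrite mderiv_normsq scalerAr.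
Qed.

Lemma laplacian_linformM y q : laplacian (linform y * q) = 2%:R * dderiv y q
  + linform y * laplacian q.
Proof.
rewrite laplacianM [laplacian (linform y)]big1 => [|i _]; last by rewrite mderiv_linform mderivC.
rewrite mul0r add0r; congr (_ * _ + _); apply: eq_bigr => i _.
by rewrite mderiv_linform mul_mpolyC.
Qed.

Lemma laplacian_normsqM q : laplacian (normsq * q) = (2 * D%:R)%:MP * q + 4%:R * euler q
  + normsq * laplacian q.
Proof.
rewrite laplacianM; have -> : laplacian normsq = (2 * D%:R)%:MP.
  rewrite /laplacian (eq_bigr (fun=> 2%:MP)) => [|i _].
    by rewrite sumr_const card_ord rmorphM /= (mpolyC_nat _ _ D) mulr_natr.
  by rewrite mderiv_normsq -mpolyC_nat mderivCM mderivXU eqxx mulr1.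
have -> : \sum_i normsq^`M(i) * q^`M(i) = 2%:R * euler q.
  by rewrite mulr_sumr; apply: eq_bigr => i _; rewrite mderiv_normsq mulrA.
by ring.
Qed.

Lemma fischer_linform y q p : fischer q (linform y * p) = fischer (dderiv y q) p.
Proof.
rewrite fischer_suml mulr_suml linear_sum; apply: eq_bigr => i _ /=.
by rewrite -scalerAl linearZ /= fischer_mulX.
Qed.

Lemma fischer_normsq q p : fischer q (normsq * p) = fischer (laplacian q) p.
Proof.
rewrite /laplacian (eq_bigr (fun i => 1 *: q^`M(i)^`M(i))) => [|i _].
  rewrite fischer_suml mulr_suml linear_sum; apply: eq_bigr => i _ /=.
  by rewrite expr2 -mulrA !fischer_mulX mul1r.
by rewrite scale1r.
Qed.

(** Differentiation lowers the degree of homogeneity by one. *)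
Lemma euler_mderiv i p : euler p^`M(i) = (euler p)^`M(i) - p^`M(i).
Proof.
apply/eqP; rewrite eq_sym subr_eq; apply/eqP.
rewrite /euler raddf_sum /=.
rewrite (eq_bigr (fun j => 'X_j * p^`M(i)^`M(j) + (i == j)%:R * p^`M(j))) => [|j _].
  rewrite big_split; congr (_ + _) => /=; rewrite (bigD1 i) //= eqxx mul1r.
  rewrite big1 ?addr0 // => j ji.
  by rewrite eq_sym (negbTE ji) mul0r.
by rewrite mderivM mderivXU mderiv_comm addrC.
Qed.

Lemma euler_dderiv y p : euler (dderiv y p) = dderiv y (euler p) - dderiv y p.
Proof.
have -> : euler (dderiv y p) = \sum_i y i *: euler p^`M(i).
  rewrite /euler; under [RHS]eq_bigr do rewrite scaler_sumr.
  rewrite [RHS]exchange_big; apply: eq_bigr => j _ /=.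
  by rewrite raddf_sum mulr_sumr; apply: eq_bigr => i _ /=; rewrite mderivZ scalerAr.
by rewrite -sumrB; apply: eq_bigr => i _; rewrite euler_mderiv scalerBr.
Qed.

Lemma laplacian_dderiv y p : laplacian (dderiv y p) = dderiv y (laplacian p).
Proof.
rewrite /laplacian /dderiv; under [LHS]eq_bigr do rewrite !mderiv_sumE.
rewrite [LHS]exchange_big; apply: eq_bigr => i _ /=.
rewrite [in RHS]mderiv_sumE [RHS]scaler_sumr; apply: eq_bigr => j _ /=.
by rewrite !mderivZ (mderiv_comm i j) (mderiv_comm i j).
Qed.

(** For [p] homogeneous of degree [n] the right side is [n * p.[y]]: this is
    Euler's identity at the point [y] itself. *)
Lemma meval_dderiv y p : (dderiv y p).@[y] = (euler p).@[y].
Proof.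
rewrite /dderiv /euler !raddf_sum; apply: eq_bigr => i _ /=.
by rewrite mevalZ mevalM mevalXU.
Qed.

Lemma mcoeff_euler p m : (euler p)@_m = (mdeg m)%:R * p@_m.
Proof.
have eulerX k : euler 'X_[k] = (mdeg k)%:R *: 'X_[k].
  rewrite mdegE natr_sum scaler_suml; apply: eq_bigr => i _.
  rewrite mderivX -scalerAr -mpolyXD.
  case: (posnP (k i)) => [->|ki]; first by rewrite !scale0r.
  rewrite addmC submK //; last by rewrite lep1mP -lt0n.
have eulerZ c q : euler (c *: q) = c *: euler q.
  by rewrite -!mul_mpolyC eulerM eulerC mul0r add0r.
have euler_sum : euler p = \sum_(k <- msupp p) (p@_k * (mdeg k)%:R) *: 'X_[k].
  rewrite {1}[p]mpolyE (big_morph euler (op1 := +%R) (id1 := 0)); first last.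
  - by rewrite -(mpolyC0 D) eulerC.
  - by move=> a b; rewrite -big_split; apply: eq_bigr => i _; rewrite mderivD mulrDr.
  by apply: eq_bigr => k _; rewrite eulerZ eulerX scalerA.
rewrite euler_sum {3}[p]mpolyE !(raddf_sum (mcoeff m)) mulr_sumr; apply: eq_bigr => k _ /=.
rewrite !mcoeffZ mcoeffX; case: eqVneq => [->|_]; last by rewrite !mulr0.
by rewrite !mulr1 mulrC.
Qed.

End Fischer.

Section Zonal.
Variables (R : realFieldType) (D : nat) (l : R).
Hypothesis lD : D%:R = 2 * l + 2.
Variables (y : 'I_D -> R).
Hypothesis y1 : \sum_i y i ^+ 2 = 1.

(** The homogenized Gegenbauer polynomial of pole [y]: at a unit vector [z] its
    value is the Gegenbauer polynomial at the scalar product of [y] and [z]. *)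
Definition zonal n : {mpoly R[D]} := geg_rec l (@mpolyC D R) (linform y) (normsq R D) n.
Local Notation Z := zonal.

Lemma zonal0 : Z 0 = 1%:MP. Proof. by []. Qed.
Lemma zonal1 : Z 1 = (2 * l)%:MP * linform y. Proof. by []. Qed.

Lemma zonalS2 n :
  n.+2%:R%:MP * Z n.+2 = (2 * (n.+1%:R + l))%:MP * (linform y * Z n.+1)
    - (n%:R + 2 * l)%:MP * (normsq R D * Z n).
Proof. by rewrite rmorph_nat [LHS]geg_recS2. Qed.

Lemma euler_zonal n : euler (Z n) = n%:R * Z n.
Proof.
elim/nat_two_step_ind: n => [||n IH0 IH1].
- by rewrite zonal0 eulerC mul0r.
- by rewrite zonal1 eulerM eulerC euler_linform; ring.
- apply: (@mulr_natS_inj _ _ (@mpolyC D R) n.+1) => /=.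
  have := congr1 (@euler _ _) (zonalS2 n).
  rewrite eulerB !eulerM !eulerC IH0 IH1 euler_linform euler_normsq !mul0r !add0r rmorph_nat => ->.
  transitivity (n.+2%:R * (n.+2%:R%:MP * Z n.+2)); last by rewrite rmorph_nat; ring.
  by rewrite zonalS2; ring.
Qed.

(** The derivative of a zonal function in the direction of its pole is zonal
    again. The induction differentiates the recurrence, then uses the recurrence
    once more to eliminate the term with [normsq]. *)
Lemma dderiv_zonal n : dderiv y (Z n.+1) = (n%:R + 2 * l)%:MP * Z n.
Proof.
elim/nat_two_step_ind: n => [||n IH0 IH1].
- by rewrite zonal1 dderivM dderivC dderiv_linform // zonal0; ring.
- apply: (@mulr_natS_inj _ _ (@mpolyC D R) 1) => /=.
  have := congr1 (dderiv y) (zonalS2 0).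
  rewrite dderivB !dderivM !dderivC !mul0r !add0r dderiv_linform // dderiv_normsq rmorph_nat => ->.
  by rewrite zonal0 zonal1; ring.
- apply: (@mulr_natS_inj _ _ (@mpolyC D R) n.+2) => /=.
  have := congr1 (dderiv y) (zonalS2 n.+1).
  rewrite dderivB !dderivM !dderivC !mul0r !add0r dderiv_linform // dderiv_normsq rmorph_nat => ->.
  rewrite IH0 IH1.
  have E : (n%:R + 2 * l)%:MP * (normsq R D * Z n)
      = (2 * (n.+1%:R + l))%:MP * (linform y * Z n.+1) - n.+2%:R%:MP * Z n.+2.
    by rewrite zonalS2; ring.
  transitivity ((2 * (n.+2%:R + l))%:MP * (Z n.+2 + (n.+1%:R + 2 * l)%:MP * (linform y * Z n.+1))
    - (n.+1%:R + 2 * l)%:MP * (2%:R * (linform y * Z n.+1) + (n%:R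
      + 2 * l)%:MP * (normsq R D * Z n))).
    by ring.
  by rewrite E; ring.
Qed.

(** Apply the Laplacian to the recurrence: it commutes with multiplication by
    [linform y] up to a derivative along [y], and with multiplication by
    [normsq] up to a multiple depending on degree and dimension. Both error
    terms are multiples of [Z n], and they cancel when the dimension is
    [2 * l + 2]. *)
Lemma laplacian_zonal n : laplacian (Z n) = 0.
Proof.
elim/nat_two_step_ind: n => [||n IH0 IH1].
- by rewrite zonal0 laplacianC.
- by rewrite zonal1 laplacianCM -[linform y]mulr1 laplacian_linformM -(mpolyC1 D) dderivC
  laplacianC; ring.
- apply: (@mulr_natS_inj _ _ (@mpolyC D R) n.+1) => /=.
  have := congr1 (@laplacian _ _) (zonalS2 n).
  rewrite laplacianB !laplacianCM laplacian_linformM laplacian_normsqM IH0 IH1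
    dderiv_zonal euler_zonal rmorph_nat => ->.
  rewrite lD; ring.
Qed.

Definition kappa n : R := \prod_(k < n) (2 * (k%:R + l)).

(** The reproducing property. Move the two multiplications of the recurrence to
    the other side of the pairing: the one by [normsq] becomes a Laplacian and
    disappears because [q] is harmonic, the one by [linform y] becomes a
    derivative along [y], which keeps [q] harmonic and homogeneous and lowers
    its degree. *)
Lemma fischer_zonal n (q : {mpoly R[D]}) :
  laplacian q = 0 -> euler q = n%:R * q -> fischer q (Z n) = kappa n * q.@[y].
Proof.
have step k (p : {mpoly R[D]}) : euler p = k.+1%:R * p ->
    euler (dderiv y p) = k%:R * dderiv y p.
  move=> Ep; rewrite euler_dderiv Ep -[k.+1%:R](mpolyC_nat D) dderivM dderivC; ring.
have evald k (p : {mpoly R[D]}) : euler p = k%:R * p -> (dderiv y p).@[y] = k%:R * p.@[y].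
  by move=> Ep; rewrite meval_dderiv Ep mevalM rmorph_nat.
have lapd (p : {mpoly R[D]}) : laplacian p = 0 -> laplacian (dderiv y p) = 0.
  by move=> Lp; rewrite laplacian_dderiv Lp -(mpolyC0 D) dderivC.
have base (p : {mpoly R[D]}) : euler p = 0%:R * p -> fischer p (Z 0) = p.@[y].
  move=> Ep; have -> : p = (p@_0)%:MP.
    apply/mpolyP => m; rewrite mcoeffC.
    case: eqVneq => [->|m0]; first by rewrite mulr1.
    have := congr1 (mcoeff m) Ep; rewrite mcoeff_euler mul0r mcoeff0 => /eqP.
    by rewrite mulf_eq0 pnatr_eq0 mdeg_eq0 (negbTE m0) /= mulr0 => /eqP.
  rewrite zonal0 mpolyC1 -mpolyX0 fischerX mevalC mcoeffC eqxx mulr1.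
  by rewrite /multi_fact big1 ?mul1r // => i _; rewrite mnm0E.
elim/nat_two_step_ind: n q => [||n IH0 IH1] q Lq Eq.
- by rewrite base // /kappa big_ord0 mul1r.
- have -> : Z 1 = (2 * l) *: (linform y * Z 0).
    by rewrite zonal1 zonal0 mulr1 mul_mpolyC.
  rewrite linearZ /= fischer_linform base; last exact: step.
  rewrite (evald 1%N) //.
  by rewrite /kappa big_ord_recl big_ord0 /=; ring.
- have Z2 : n.+2%:R *: Z n.+2 = (2 * (n.+1%:R + l)) *: (linform y * Z n.+1)
      - (n%:R + 2 * l) *: (normsq R D * Z n).
    by rewrite -!mul_mpolyC zonalS2.
  have := congr1 (fischer q) Z2.
  rewrite linearB !linearZ /= fischer_linform fischer_normsq Lq.
  rewrite IH1; [|exact: lapd|exact: step].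
  rewrite (evald n.+2) //.
  have -> : fischer 0 (Z n) = 0 by apply: big1 => m _; rewrite mcoeff0; ring.
  have n2 : n.+2%:R != 0 :> R by rewrite pnatr_eq0.
  by move=> E; apply: (mulfI n2); rewrite E /kappa [in RHS]big_ord_recr /=; ring.
Qed.

End Zonal.

(** By the reproducing property the kernel is, up to a positive constant, the
    Gram matrix of the zonal polynomials of poles [y i] for the Fischer pairing;
    so the quadratic form is the pairing of a polynomial with itself. *)
Lemma geg_rec_posdef (R : realFieldType) (D : nat) (l : R) (n N : nat)
    (y : 'I_N -> 'I_D -> R) (c : 'I_N -> R) :
  D%:R = 2 * l + 2 -> 0 < l -> (forall i, \sum_k y i k ^+ 2 = 1) ->
  0 <= \sum_i \sum_j c i * c j
         * geg_rec l idfun (\sum_k y i k * y j k) 1 n.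
Proof.
move=> lD l0 y1.
pose P : {mpoly R[D]} := \sum_i c i *: zonal l (y i) n.
have kn0 : 0 < kappa l n.
  by apply: prodr_gt0 => k _; rewrite mulr_gt0 // ltr_wpDl.
have ev i j : (zonal l (y i) n).@[y j] = geg_rec l idfun (\sum_k y i k * y j k) 1 n.
  rewrite /zonal (rmorph_geg_rec _ (iota' := idfun)) => [|a]; last by rewrite /= mevalC.
  congr (geg_rec _ _ _ _ n) => /=.
    by rewrite raddf_sum; apply: eq_bigr => k _; rewrite /= mevalZ mevalXU.
  by rewrite raddf_sum -(y1 j); apply: eq_bigr => k _; rewrite /= !expr2 mevalM mevalXU.
have -> : \sum_i \sum_j c i * c j * geg_rec l idfun (\sum_k y i k * y j k) 1 n
    = (kappa l n)^-1 * fischer P P.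
  rewrite {2}/P linear_sum mulr_sumr exchange_big.
  apply: eq_bigr => j _ /=; rewrite linearZ /= fischer_zonal //.
  - rewrite mulrCA mulKf ?gt_eqF //.
    rewrite raddf_sum mulr_sumr /=; apply: eq_bigr => i _.
    by rewrite -ev mevalZ; ring.
  - rewrite /P; elim/big_ind: _ => [|p q p0 q0|i _].
    + by rewrite -(mpolyC0 D) laplacianC.
    + by rewrite -[q]opprK laplacianB p0 -[- q]add0r laplacianB q0 -(mpolyC0 D) laplacianC !subr0.
    + by rewrite -mul_mpolyC laplacianCM laplacian_zonal // mulr0.
  - rewrite /P mulr_sumr (big_morph (@euler R D) (op1 := +%R) (id1 := 0)) => [|p q|].
    + by apply: eq_bigr => i _; rewrite -mul_mpolyC eulerM eulerC euler_zonal; ring.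
    + by rewrite -big_split; apply: eq_bigr => i _; rewrite mderivD mulrDr.
    + by rewrite -(mpolyC0 D) eulerC.
by rewrite mulr_ge0 ?fischer_ge0 // invr_ge0 ltW.
Qed.
End SphericalHarmonics.

(** * Identities for Gegenbauer polynomials *)

Section GegenbauerPolynomials.
Variables (R : realFieldType) (l : R).

Definition gegpoly (n : nat) : {poly R} := geg_rec l (@polyC R) 'X 1 n.
Local Notation G := gegpoly.

Lemma gegpoly0 : G 0 = 1. Proof. by []. Qed.
Lemma gegpoly1 : G 1 = (2 * l)%:P * 'X. Proof. by []. Qed.

Lemma gegpolyS2 n :
  n.+2%:R * G n.+2
  = (2 * (n.+1%:R + l))%:P * ('X * G n.+1) - (n%:R + 2 * l)%:P * G n.
Proof. by rewrite [LHS]geg_recS2 mul1r. Qed.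

Lemma horner_gegpoly n t : (G n).[t] = geg_rec l idfun t 1 n.
Proof.
rewrite -[_.[t]]/(horner_eval t (G n)).
rewrite (rmorph_geg_rec _ (iota' := idfun)) => [|c]; last exact: hornerC.
by rewrite rmorph1; congr (geg_rec _ _ _ _ n); exact: hornerX.
Qed.

Lemma horner_gegpolyS2 n t :
  n.+2%:R * (G n.+2).[t]
  = 2 * (n.+1%:R + l) * t * (G n.+1).[t] - (n%:R + 2 * l) * (G n).[t].
Proof. by rewrite !horner_gegpoly geg_recS2 /=; ring. Qed.

(** At [1] the second-order recurrence collapses to a first-order one. *)
Lemma gegpoly_at1S n : n.+1%:R * (G n.+1).[1] = (n%:R + 2 * l) * (G n).[1].
Proof.
elim: n => [|n IH]; first by rewrite gegpoly1 gegpoly0 !hornerE; ring.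
rewrite horner_gegpolyS2.
have -> : (n%:R + 2 * l) * (G n).[1] = n.+1%:R * (G n.+1).[1] by [].
by ring.
Qed.

Lemma gegpoly_at1 n : (G n).[1] = (\prod_(i < n) (2 * l + i%:R)) / n`!%:R.
Proof.
elim: n => [|n IH].
  by rewrite big_ord0 gegpoly0 hornerC fact0 divr1.
have n1 : n.+1%:R != 0 :> R by rewrite pnatr_eq0.
have nf : n`!%:R != 0 :> R by rewrite pnatr_eq0 -lt0n fact_gt0.
apply: (mulfI n1); rewrite gegpoly_at1S IH big_ord_recr /= factS natrM.
by field; rewrite nf addrC natr1 n1.
Qed.

(** The two classical derivative relations are proved together, since each step
    of the induction uses both: the first one comes from differentiating the
    recurrence, the second one by eliminating derivatives between them. *)
Lemma gegpoly_deriv n :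
  (G n.+1)^`() - 'X * (G n)^`() = (n%:R + 2 * l)%:P * G n /\
  'X * (G n.+1)^`() - (G n)^`() = n.+1%:R * G n.+1.
Proof.
elim: n => [|n [A B]].
  rewrite gegpoly1 gegpoly0 derivM !derivC derivX; split; ring.
have A' : (G n.+2)^`() - 'X * (G n.+1)^`() = (n.+1%:R + 2 * l)%:P * G n.+1.
  apply: (@mulr_natS_inj _ _ (@polyC R) n.+1).
  have := congr1 deriv (gegpolyS2 n).
  rewrite mulr_natl derivMn -[LHS]mulr_natl derivB !derivM !derivC derivX => E.
  transitivity (n.+2%:R * (G n.+2)^`() - n.+2%:R * ('X * (G n.+1)^`())); first by ring.
  rewrite E.
  have -> : (G n)^`() = 'X * (G n.+1)^`() - n.+1%:R * G n.+1 by rewrite -B; ring.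
  by ring.
split=> //.
have -> : (G n.+2)^`() = 'X * (G n.+1)^`() + (n.+1%:R + 2 * l)%:P * G n.+1.
  by rewrite -A'; ring.
rewrite gegpolyS2.
have -> : (n%:R + 2 * l)%:P * G n = (G n.+1)^`() - 'X * ('X * (G n.+1)^`() - n.+1%:R * G n.+1).
  by rewrite -A -B; ring.
by ring.
Qed.

(** Eliminating [(G n)^`()] between the two derivative relations gives
    [(1 - 'X ^+ 2) * (G n.+1)^`()] without other derivatives; differentiate that
    relation. *)
Lemma gegpoly_ode n :
  (1 - 'X ^+ 2) * (G n)^`()^`()
  = (2 * l + 1)%:P * 'X * (G n)^`() - (n%:R * (n%:R + 2 * l))%:P * G n.
Proof.
case: n => [|n].
  by rewrite gegpoly0 !derivC; ring.
have [A B] := gegpoly_deriv n.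
(* First-order relation, free of [(G n)^`()]. *)
have D : (1 - 'X ^+ 2) * (G n.+1)^`() = (n%:R + 2 * l)%:P * G n - n.+1%:R * ('X * G n.+1).
  have -> : n.+1%:R * ('X * G n.+1) = 'X * (n.+1%:R * G n.+1) by ring.
  by rewrite -A -B; ring.
have := congr1 deriv D.
rewrite !mulr_natl derivB derivMn !derivM derivB derivXn -polyC1 !derivC derivX /=.
have -> : (G n)^`() = 'X * (G n.+1)^`() - n.+1%:R * G n.+1 by rewrite -B; ring.
rewrite mulr_natl.
move=> E; transitivity ((0 - 'X *+ 2) * (G n.+1)^`() + (1%:P - 'X ^+ 2) * (G n.+1)^`()^`()
  + 'X *+ 2 * (G n.+1)^`()).
  by ring.
by rewrite expr1 in E; rewrite E; ring.
Qed.

(** Multiplied by the weight, the left side is the derivative of the Wronskian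
    times a higher power of [1 - 'X ^+ 2]; so this is Green's identity, the
    source of orthogonality. *)
Lemma gegpoly_wronskian m n :
  (1 - 'X ^+ 2) * ((G m)^`() * G n - G m * (G n)^`())^`()
   - (2 * l + 1)%:P * 'X * ((G m)^`() * G n - G m * (G n)^`())
  = (n%:R * (n%:R + 2 * l) - m%:R * (m%:R + 2 * l))%:P * (G m * G n).
Proof.
rewrite derivB !derivM.
transitivity (G n * ((1 - 'X ^+ 2) * (G m)^`()^`()) - G m * ((1 - 'X ^+ 2) * (G n)^`()^`())
  - (2 * l + 1)%:P * 'X * ((G m)^`() * G n - G m * (G n)^`())).
  by ring.
by rewrite !gegpoly_ode; ring.
Qed.

Lemma gegpoly_odd_at0 n : (G n.*2.+1).[0] = 0.
Proof.
elim: n => [|n IH]; first by rewrite gegpoly1 !hornerE.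
have n3 : n.*2.+3%:R != 0 :> R by rewrite pnatr_eq0.
by rewrite doubleS; apply: (mulfI n3); rewrite horner_gegpolyS2 IH; ring.
Qed.

Lemma gegpoly_even_deriv_at0 n : (G n.*2)^`().[0] = 0.
Proof.
have [_ /(congr1 (horner^~ 0))] := gegpoly_deriv n.*2.
rewrite mulr_natl hornerMn gegpoly_odd_at0 mul0rn hornerD hornerN hornerM hornerX mul0r sub0r.
by move/eqP; rewrite oppr_eq0 => /eqP.
Qed.

Section Positive.
Hypothesis l0 : 0 < l.

Lemma gegpoly_at1_gt0 n : 0 < (G n).[1].
Proof.
rewrite gegpoly_at1 divr_gt0 ?ltr0n ?fact_gt0 //.
by apply: prodr_gt0 => i _; rewrite ltr_wpDr // mulr_gt0.
Qed.

Lemma size_gegpoly n : size (G n) = n.+1.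
Proof.
suff [le_s gt0] : (size (G n) <= n.+1)%N /\ 0 < (G n)`_n.
  apply/eqP; rewrite eqn_leq le_s ltnNge /=; apply/negP => s_le.
  by move: gt0; rewrite nth_default ?ltxx.
elim/nat_two_step_ind: n => [||n [s0 c0] [s1 c1]].
- by rewrite gegpoly0 size_poly1 coefC ltr01.
- rewrite gegpoly1 coefCM coefX mulr1 mulr_gt0 //; split=> //.
  by apply: leq_trans (size_polyMleq _ _) _; rewrite size_polyX addnC /= ltnS size_polyC_leq1.
- have -> : G n.+2 = n.+2%:R^-1 *: (n.+2%:R * G n.+2).
    by rewrite -mul_polyC -[X in X * G _](rmorph_nat (@polyC R)) mulrA -rmorphM mulVf
      ?pnatr_eq0 ?mul1r.
  rewrite gegpolyS2; split.
    apply: leq_trans (size_scale_leq _ _) _.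
    apply: leq_trans (size_polyD _ _) _; rewrite geq_max size_polyN !mul_polyC; apply/andP; split.
      apply: leq_trans (size_scale_leq _ _) _; rewrite mulrC.
      by apply: leq_trans (size_polyMleq _ _) _; rewrite size_polyX addnC.
    by apply: leq_trans (size_scale_leq _ _) _; apply: (leq_trans s0); exact: (leq_addl 2).
  rewrite coefZ coefB !coefCM coefXM /= [(G n)`_n.+2]nth_default ?mulr0 ?subr0; last first.
    by apply: (leq_trans s0).
  by rewrite mulr_gt0 ?invr_gt0 // mulr_gt0 // mulr_gt0 // ltr_wpDl.
Qed.

(** Both values satisfy first-order recurrences in [m], and the square of the
    quotient of the values at [0] and [1] is multiplied at each step by
    [((2 m + 1) / (2 m + 1 + 2 l)) ^+ 2], which is at most
    [(2 m + 1) / (2 m + 3)] as soon as [2 l] is at least [1]. *)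
Lemma gegpoly_ratio m : 1 <= 2 * l ->
  m.*2.+1%:R * (G m.*2).[0] ^+ 2 <= (G m.*2).[1] ^+ 2.
Proof.
move=> l1; elim: m => [|m IH]; first by rewrite gegpoly0 !hornerC expr1n mulr1.
have E1 : m.*2.+2%:R * m.*2.+1%:R * (G m.*2.+2).[1]
     = (m.*2.+1%:R + 2 * l) * (m.*2%:R + 2 * l) * (G m.*2).[1].
  by rewrite -mulrA mulrCA gegpoly_at1S mulrCA gegpoly_at1S mulrA.
have E0 : m.*2.+2%:R * (G m.*2.+2).[0] = - (m.*2%:R + 2 * l) * (G m.*2).[0].
  by rewrite horner_gegpolyS2; ring.
rewrite doubleS.
have c0 : 0 < m.*2.+2%:R ^+ 2 * m.*2.+1%:R ^+ 2 :> R by rewrite mulr_gt0 // exprn_gt0.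
rewrite -(ler_pM2l c0).
pose a : R := m.*2%:R; rewrite -/a in E0 E1.
have a0 : 0 <= a by rewrite ler0n.
have -> : m.*2.+3%:R = a + 3 :> R by rewrite -[m.*2.+3]addn3 natrD.
have b : m.*2.+2%:R = a + 2 :> R by rewrite -[m.*2.+2]addn2 natrD.
have b' : m.*2.+1%:R = a + 1 :> R by rewrite -[m.*2.+1]addn1 natrD.
rewrite b b' in E0 E1 IH c0 *.
have -> : (a + 2) ^+ 2 * (a + 1) ^+ 2 * ((a + 3) * (G m.*2.+2).[0] ^+ 2)
    = (a + 3) * (a + 1) ^+ 2 * ((a + 2) * (G m.*2.+2).[0]) ^+ 2 by ring.
have -> : (a + 2) ^+ 2 * (a + 1) ^+ 2 * (G m.*2.+2).[1] ^+ 2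
    = ((a + 2) * (a + 1) * (G m.*2.+2).[1]) ^+ 2 by ring.
rewrite E0 E1 !exprMn sqrrN.
set g0 := (G m.*2).[0]; set g1 := (G m.*2).[1]; rewrite -/g0 -/g1 in IH.
have h : (a + 3) * (a + 1) ^+ 2 * g0 ^+ 2 <= (a + 1 + 2 * l) ^+ 2 * g1 ^+ 2.
  apply: le_trans (_ : (a + 2) ^+ 2 * g1 ^+ 2 <= _).
    apply: le_trans (_ : (a + 3) * (a + 1) * g1 ^+ 2 <= _).
      have -> : (a + 3) * (a + 1) ^+ 2 * g0 ^+ 2
        = (a + 3) * (a + 1) * ((a + 1) * g0 ^+ 2) by ring.
      apply: ler_wpM2l => //.
      by rewrite mulr_ge0 //; lra.
    by apply: ler_wpM2r; [exact: sqr_ge0|nra].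
  apply: ler_wpM2r; first exact: sqr_ge0.
  by rewrite -subr_ge0 subr_sqr mulr_ge0 //; lra.
have := ler_wpM2l (sqr_ge0 (a + 2 * l)) h.
by congr (_ <= _); ring.
Qed.
End Positive.
End GegenbauerPolynomials.

(** The Sonin energy of the differential equation, multiplied by a power of
    [1 - 'X ^+ 2] chosen so that all terms with a derivative cancel and only one
    term, of constant sign on the unit interval, is left. *)
Lemma gegpoly_energy (R : realFieldType) (l : R) k n :
  2 * l = k.+1%:R ->
  let N := n%:R * (n%:R + 2 * l) in let G := gegpoly l n in
  ((1 - 'X ^+ 2) ^+ k.+1 * (N%:P * G ^+ 2 + (1 - 'X ^+ 2) * G^`() ^+ 2))^`()
  = - (2 * k.+1%:R * N)%:P * ('X * (1 - 'X ^+ 2) ^+ k * G ^+ 2).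
Proof.
move=> lk N G.
have E := gegpoly_ode l n; rewrite -/N -/G in E.
set W : {poly R} := 1 - 'X ^+ 2 in E *.
have dW : W^`() = - (2%:R * 'X).
  by rewrite derivB derivXn -polyC1 derivC /= expr1 mulr_natl sub0r.
have dS : (N%:P * G ^+ 2 + W * G^`() ^+ 2)^`()
    = N%:P * (2%:R * G * G^`()) + (W^`() * G^`() ^+ 2 + 2%:R * G^`() * (W * G^`()^`())).
  by rewrite derivD !derivM derivC; ring.
rewrite derivM deriv_exp /= dS E dW (exprS W k) -mulr_natl lk.
by move: W N G {E dS dW} => W N G; ring.
Qed.

From mathcomp Require Import all_classical all_reals all_analysis.
Import numFieldNormedType.Exports.

Local Open Scope classical_set_scope.
Local Open Scope ring_scope.

(** * Decay inside the interval *)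

Section Decay.
Variables (R : realType) (l : R) (k : nat).
Hypothesis lk : 2 * l = k.+1%:R.
Local Notation G := (gegpoly l).

(** The weighted energy decreases on the unit interval; at [0] it reduces to the
    square of the value, because the derivative of an even polynomial vanishes
    there. *)
Lemma gegpoly_even_bound m t : 0 <= t <= 1 ->
  (1 - t ^+ 2) ^+ k.+1 * (G m.*2).[t] ^+ 2 <= (G m.*2).[0] ^+ 2.
Proof.
move=> /andP[t0 t1].
have w0 : 0 <= 1 - t ^+ 2 by rewrite subr_ge0 expr_le1.
have w1 : 1 - t ^+ 2 <= 1 by rewrite lerBlDr lerDl sqr_ge0.
(* In degree [0] the energy vanishes identically and gives no bound. *)
case: m => [|m].
  by rewrite gegpoly0 !hornerC expr1n mulr1 exprn_ile1.
set n := m.+1.*2.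
pose N := n%:R * (n%:R + 2 * l).
have N0 : 0 < N by rewrite /N lk -natrD -natrM ltr0n.
have E := gegpoly_energy n lk; rewrite -/N /= in E.
set F : {poly R} := (X in X^`() = _) in E.
have mono : F.[t] <= F.[0].
  apply: (@ler0_derive1_le_cc R (horner F) 0 1) => //.
  - move=> x; rewrite in_itv /= => /andP[x0 x1]; rewrite -derivE E.
    rewrite hornerM hornerN hornerC mulNr oppr_le0 mulr_ge0 //.
      by apply: mulr_ge0; [exact: mulr_ge0|exact: ltW].
    rewrite !hornerM hornerX !horner_exp hornerD hornerN hornerC hornerXn.
    apply: mulr_ge0; last exact: sqr_ge0.
    apply: mulr_ge0; first exact: ltW.
    by rewrite exprn_ge0 // subr_ge0 expr_le1 // ltW.
  - by apply: continuous_subspaceT; exact: continuous_horner.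
  - by rewrite in_itv /= t0.
  - by rewrite in_itv /= lexx ler01.
move: mono; rewrite /F !hornerM !hornerD !hornerM !horner_exp !hornerD !hornerN !hornerXn.
rewrite !hornerC gegpoly_even_deriv_at0 expr0n /= subr0 !expr1n mul1r.
rewrite ?mulr0 ?mulr1 ?mul1r ?addr0 ?mulrDr -?expr2 => mono.
rewrite -(ler_pM2l N0); apply: le_trans mono.
rewrite mulrCA lerDl mulr_ge0 ?exprn_ge0 //.
by rewrite mulr_ge0 // sqr_ge0.
Qed.

(** In particular, at a fixed [t < 1] the quotient of the values at [t] and at
    [1] tends to [0] as the even degree grows. *)
Lemma gegpoly_even_decay m t : 0 <= t <= 1 ->
  m.*2.+1%:R * ((1 - t ^+ 2) ^+ k.+1 * (G m.*2).[t] ^+ 2) <= (G m.*2).[1] ^+ 2.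
Proof.
move=> t01; apply: le_trans (gegpoly_ratio m _); last by rewrite lk ler1n.
by rewrite ler_pM2l ?ltr0n // gegpoly_even_bound.
Qed.
End Decay.

(** * The weighted inner product and uniqueness of the Gegenbauer family *)

(** This makes the zeros of a nonzero polynomial Lebesgue negligible. *)
Lemma poly_roots_seq (F : fieldType) (p : {poly F}) :
  p != 0 -> exists r : seq F, forall t, root p t -> t \in r.
Proof.
elim: (size p) {-2}p (leqnn (size p)) => {p} [|n IH] p sp p0.
  by move: sp; rewrite leqn0 size_poly_eq0 (negbTE p0).
have [[x px]|npx] := pselect (exists x, root p x); last first.
  by exists [::] => t pt; case: npx; exists t.
have /factor_theorem [q pq] := px.
have q0 : q != 0 by apply: contraNneq p0 => q0; rewrite pq q0 mul0r.
have [|r qr] := IH q _ q0.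
  by move: sp; rewrite pq size_mul ?polyXsubC_eq0 // size_XsubC addn2.
exists (x :: r) => t; rewrite pq rootM root_XsubC inE orbC.
by case/orP => [->//|/qr ->]; rewrite orbT.
Qed.

Section Orthogonality.
Variables (R : realType) (l : R) (k : nat).
Hypothesis lk : 2 * l = k.+1%:R.
Local Notation G := (gegpoly l).
Local Notation mu := (@lebesgue_measure R).
Local Notation I11 := (`[-1, 1]%classic : set R).

Definition semicircle (t : R) : R := Num.sqrt (1 - t ^+ 2).

Definition weighted_int (p : {poly R}) : R :=
  Rintegral mu I11 (fun t => p.[t] * semicircle t ^+ k).

Lemma semicircle_arg_ge0 (t : R) : I11 t -> 0 <= 1 - t ^+ 2.
Proof.
rewrite /= in_itv /= => /andP[t0 t1].
by rewrite subr_ge0 -(real_normK (num_real t)) expr_le1 // ler_norml t0.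
Qed.

(** The exponent [l - 2^-1] is half an integer, so the real power is a natural
    power of a square root, continuous on the closed interval. *)
Lemma powR_semicircle t : I11 t -> (1 - t ^+ 2) `^ (l - 2^-1) = semicircle t ^+ k.
Proof.
move=> /semicircle_arg_ge0 w0; have -> : l - 2^-1 = 2^-1 * k%:R.
  apply: (@mulfI _ 2); rewrite ?pnatr_eq0 // mulrBr lk mulrA.
  by rewrite mulfV ?pnatr_eq0 // mul1r -natr1 addrK.
by rewrite powRrM powR12_sqrt // powR_mulrn // sqrtr_ge0.
Qed.

Lemma semicircle_continuous : continuous semicircle.
Proof.
move=> t; apply: continuous_comp; last exact: sqrt_continuous.
have -> : (fun t : R => 1 - t ^+ 2) = horner (1 - 'X ^+ 2).
  by apply/funext => x; rewrite !hornerE.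
exact: continuous_horner.
Qed.

Lemma weighted_continuous (p : {poly R}) : continuous (fun t => p.[t] * semicircle t ^+ k).
Proof.
move=> t; apply: cvgM; first exact: continuous_horner.
apply: (@continuous_comp _ _ _ semicircle (fun x => x ^+ k)); first exact: semicircle_continuous.
exact: exprn_continuous.
Qed.

Lemma weighted_integrable (p : {poly R}) :
  mu.-integrable I11 (EFin \o (fun t => p.[t] * semicircle t ^+ k)).
Proof.
apply: continuous_compact_integrable; first exact: segment_compact.
by apply: continuous_subspaceT; exact: weighted_continuous.
Qed.

Lemma weighted_intD p q : weighted_int (p + q) = weighted_int p + weighted_int q.
Proof.
rewrite /weighted_int -RintegralD //; [|exact: weighted_integrable|exact: weighted_integrable].
by apply: eq_Rintegral => t _; rewrite hornerD mulrDl.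
Qed.

Lemma weighted_intZ c p : weighted_int (c *: p) = c * weighted_int p.
Proof.
rewrite /weighted_int -RintegralZl //; last exact: weighted_integrable.
by apply: eq_Rintegral => t _; rewrite hornerZ mulrA.
Qed.

(** By Green's identity the integrand is, up to a nonzero constant, the
    derivative of [semicircle ^+ k.+2] times the Wronskian, which vanishes at
    both ends. *)
Lemma gegpoly_orthogonal m n : m != n -> weighted_int (G m * G n) = 0.
Proof.
move=> mn; pose c : R := n%:R * (n%:R + 2 * l) - m%:R * (m%:R + 2 * l).
have c0 : c != 0.
  rewrite /c lk -!natrD -!natrM subr_eq0 eqr_nat.
  by case: ltngtP mn => // h _; apply/eqP; nia.
suff : weighted_int (c *: (G m * G n)) = 0.
  by rewrite weighted_intZ => /eqP; rewrite mulf_eq0 (negbTE c0) => /eqP.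
have [W Wode] : exists W, (1 - 'X ^+ 2) * W^`() - (k.+1%:R + 1)%:P * 'X * W
    = c%:P * (G m * G n).
  by exists ((G m)^`() * G n - G m * (G n)^`()); rewrite -lk gegpoly_wronskian.
(* An antiderivative that vanishes at both ends of the interval. *)
pose F := (fun x : R => semicircle x ^+ k.+2 * W.[x]).
have dF (x : R) : x \in `]-1, 1[ -> is_derive x 1 F ((c *: (G m * G n)).[x] * semicircle x ^+ k).
  rewrite in_itv /= => /andP[x0 x1].
  have w0 : 0 < 1 - x ^+ 2.
    by rewrite subr_gt0 -(real_normK (num_real x)) expr_lt1 // ltr_norml x0.
  have s0 : semicircle x != 0 by rewrite gt_eqF // sqrtr_gt0.
  have dw : is_derive x 1 (fun t : R => 1 - t ^+ 2) (- (2 * x)).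
    have -> : (fun t : R => 1 - t ^+ 2) = horner (1 - 'X ^+ 2).
      by apply/funext => z; rewrite !hornerE.
    have -> : - (2 * x) = (1 - 'X ^+ 2)^`().[x].
      by rewrite derivB derivXn -polyC1 derivC /= !hornerE; ring.
    exact: is_derive_poly.
  have dc : is_derive x 1 semicircle (- x / semicircle x).
    have := @is_derive1_comp R (@Num.sqrt R) (fun t : R =>
      1 - t ^+ 2) x _ _ (is_derive1_sqrt w0) dw.
    by congr (is_derive _ _ _ _); rewrite -/(semicircle x); field.
  have -> : F = (semicircle ^+ k.+2) * horner W.
    by apply/funext => z; rewrite /F fctE exprfctE.
  apply: is_derive_eq.
  have := congr1 (horner^~ x) Wode.
  rewrite !(hornerM, hornerD, hornerN, hornerC, hornerXn, hornerX, hornerZ).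
  rewrite -[1 - x ^+ 2]sqr_sqrtr ?ltW // -/(semicircle x) => E.
  have -> : (semicircle ^+ k.+2) x = semicircle x ^+ k.+2 by rewrite exprfctE.
  rewrite /= /GRing.scale /=; set s := semicircle x in s0 E *.
  have -> : c * ((G m).[x] * (G n).[x]) * s ^+ k
      = (s ^+ 2 * W^`().[x] - (k.+1%:R + 1) * x * W.[x]) * s ^+ k by rewrite E.
  by rewrite !exprS -!natr1; field.
have cF : continuous F.
  move=> t; apply: cvgM; last exact: continuous_horner.
  apply: (@continuous_comp _ _ _ semicircle (fun x => x ^+ k.+2)); first
    exact: semicircle_continuous.
  exact: exprn_continuous.
rewrite /weighted_int /Rintegral (@continuous_FTC2 _ _ F) //=.
- by rewrite /F /semicircle !expr1n sqrrN expr1n subrr sqrtr0 !expr0n !mul0r subrr.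
- by apply: continuous_subspaceT; exact: weighted_continuous.
- split; [|apply: cvg_at_right_filter; exact: cF|apply: cvg_at_left_filter; exact: cF].
  by move=> x /dF [].
- by move=> x /dF ?; rewrite derive1E derive_val.
Qed.

(** If [p] were nonzero, the integrand would be positive on the open interval
    outside the finitely many roots of [p], and nonnegative with zero
    integral. *)
Lemma weighted_int_sqr_eq0 p : weighted_int (p * p) = 0 -> p = 0.
Proof.
move=> J0; apply/eqP; apply: contraT => p0.
pose g (t : R) : R := (p * p).[t] * semicircle t ^+ k.
have g0 t : 0 <= g t by rewrite mulr_ge0 ?exprn_ge0 ?sqrtr_ge0 // hornerM -expr2 sqr_ge0.
have ig : mu.-integrable I11 (EFin \o g) by exact: weighted_integrable.
have mg := measurable_int mu ig.
have : (\int[mu]_(t in I11) `|(EFin \o g) t| = 0)%E.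
  under eq_integral do rewrite /= ger0_norm //.
  have := J0; rewrite /weighted_int /Rintegral -/g => /eqP.
  by rewrite fine_eq0 ?integrable_fin_num // => /eqP.
move=> /(ae_eq_integral_abs mu _ mg) -/(_ (measurable_itv _)) [N [mN N0 sN]].
have [r pr] := poly_roots_seq p0.
pose J : set R := `]-1, 1[%classic.
have sub : J `<=` N `|` [set` r].
  move=> t; rewrite /J /= in_itv /= => /andP[t0 t1].
  have [/pr|npt] := boolP (root p t); [by right|left].
  apply: sN => /= /(_ _) h.
  have : I11 t by rewrite /= in_itv /= (ltW t0) (ltW t1).
  move=> /h [] /eqP; apply/negP.
  rewrite /g mulf_neq0 // ?hornerM ?mulf_neq0 // expf_neq0 // gt_eqF // sqrtr_gt0.
  by rewrite subr_gt0 -(real_normK (num_real t)) expr_lt1 // ltr_norml t0.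
have mr : measurable ([set` r] : set R).
  by apply: countable_measurable => //; apply: finite_set_countable; exact: finite_seq.
have r0 : mu [set` r] = 0%E.
  by apply: countable_lebesgue_measure0; apply: finite_set_countable; exact: finite_seq.
have : (mu J <= 0)%E.
  apply: (@le_trans _ _ (mu (N `|` [set` r]))).
    by apply: le_measure; rewrite ?inE; [exact: measurable_itv|exact: measurableU|].
  apply: (@le_trans _ _ (mu N + mu [set` r])%E); first exact: measureU2.
  by rewrite N0 r0 adde0.
have h : -1 < 1 :> R by lra.
rewrite /J lebesgue_measure_itv /= lte_fin h -EFinD lee_fin => h2.
by suff : False by []; lra.
Qed.

Let l0 : 0 < l.
Proof. by have : 0 < 2 * l by [rewrite lk ltr0n]; rewrite pmulr_rgt0. Qed.

Lemma gegpoly_lead_neq0 n : (G n)`_n != 0.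
Proof.
have := lead_coef_eq0 (G n); rewrite lead_coefE size_gegpoly //= => ->.
by rewrite -size_poly_eq0 size_gegpoly.
Qed.

Lemma size_sub_gegpoly n (p : {poly R}) : (size p <= n.+1)%N ->
  (size (p - (p`_n / (G n)`_n) *: G n)%R <= n)%N.
Proof.
move=> sp; apply/leq_sizeP => j; rewrite leq_eqVlt coefB coefZ.
case/orP => [/eqP <-|nj]; first by rewrite divfK ?subrr // gegpoly_lead_neq0.
rewrite [p`_j]nth_default ?(leq_trans sp nj) //.
by rewrite [(G n)`_j]nth_default ?size_gegpoly // mulr0 subrr.
Qed.

(** The first [n] Gegenbauer polynomials span the polynomials of degree less
    than [n], because their degrees are [0], ..., [n.-1]. *)
Lemma weighted_int_span n (q : {poly R}) : (forall m, (m < n)%N -> weighted_int (q * G m) = 0) ->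
  forall p : {poly R}, (size p <= n)%N -> weighted_int (q * p) = 0.
Proof.
elim: n => [|n IH] qG p sp.
  move: sp; rewrite leqn0 size_poly_eq0 => /eqP ->.
  by rewrite mulr0 -(scale0r 0) weighted_intZ mul0r.
pose c := p`_n / (G n)`_n.
have -> : q * p = q * (p - c *: G n) + c *: (q * G n).
  by rewrite -!mul_polyC; ring.
rewrite weighted_intD weighted_intZ qG // mulr0 addr0 IH ?size_sub_gegpoly //.
by move=> m mn; rewrite qG // ltnW.
Qed.

Lemma gegenbauer_integral (p q : {poly R}) :
  Rintegral mu I11 (fun t => p.[t] * q.[t] * (1 - t ^+ 2) `^ (l - 2^-1))
  = weighted_int (p * q).
Proof.
apply: eq_Rintegral => t; rewrite inE => tI.
by rewrite powR_semicircle // hornerM.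
Qed.

Lemma gegpoly_is_gegenbauer : is_gegenbauer l G.
Proof.
split=> [n|m n mn|n]; first exact: size_gegpoly.
- by rewrite gegenbauer_integral gegpoly_orthogonal.
- exact: gegpoly_at1.
Qed.

(** If the two families agree below [n], then the combination [D] of their
    [n]-th members that cancels the leading coefficients has degree less than
    [n] and is orthogonal to all such polynomials, itself included; so the
    [n]-th members are proportional, and the value at [1] fixes the factor. *)
Lemma is_gegenbauer_unique C : is_gegenbauer l C -> C =1 G.
Proof.
move=> [sC oC C1] n; elim/ltn_ind: n => n IH.
pose c := (C n)`_n / (G n)`_n.
pose D := C n - c *: G n.
have sD : (size D <= n)%N by rewrite size_sub_gegpoly // sC.
have CG : C n = c *: G n.
  apply/eqP; rewrite -subr_eq0; apply/eqP/weighted_int_sqr_eq0.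
  apply: (@weighted_int_span n) => // m mn; rewrite -/D.
  have -> : D * G m = C n * C m + (- c) *: (G n * G m).
    by rewrite /D -(IH m mn) -!mul_polyC; ring.
  by rewrite weighted_intD weighted_intZ gegpoly_orthogonal ?gtn_eqF // mulr0 addr0
    -gegenbauer_integral oC ?gtn_eqF.
have c1 : c = 1.
  have := C1 n; rewrite CG hornerZ gegpoly_at1 => /eqP.
  have g1 := gegpoly_at1_gt0 l0 n; rewrite gegpoly_at1 in g1.
  by rewrite -subr_eq0 -[X in _ - X]mul1r -mulrBl mulf_eq0 (gt_eqF g1) orbF subr_eq0 => /eqP.
by rewrite CG c1 scale1r.
Qed.

Lemma gegenbauerE n : gegenbauer l n = G n.
Proof.
apply: is_gegenbauer_unique; rewrite /gegenbauer.
exact: (xgetPex (fun=> 0) (ex_intro _ _ gegpoly_is_gegenbauer)).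
Qed.

End Orthogonality.

(** * Quadratic forms *)

Section QuadraticForms.
Variable R : realType.

Lemma quad_formE N (A : 'M[R]_N) (c : 'rV[R]_N) :
  (c *m A *m c^T) ord0 ord0 = \sum_i \sum_j c ord0 i * c ord0 j * A i j.
Proof.
rewrite mxE exchange_big; apply: eq_bigr => j _ /=.
rewrite !mxE mulr_suml; apply: eq_bigr => i _.
by rewrite mulrAC.
Qed.

(** An isotropic vector of a nonnegative form lies in its kernel: perturb the
    vector along the [k]-th coordinate by the amount that minimizes the form;
    the minimum is [- b ^+ 2 / B k k], where [b] is the sum in question. *)
Lemma psd_null_row (I : finType) (B : I -> I -> R) (c : I -> R) (k : I) :
  (forall i j, B i j = B j i) ->
  (forall c : I -> R, 0 <= \sum_i \sum_j c i * c j * B i j) ->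
  \sum_i \sum_j c i * c j * B i j = 0 -> 0 < B k k ->
  \sum_i c i * B i k = 0.
Proof.
move=> Bsym Bpsd c0 Bk; set b := \sum_i _.
pose s := - b / B k k; pose e i : R := (i == k)%:R.
have ek (F : I -> R) : \sum_i e i * F i = F k.
  rewrite (bigD1 k) //= big1 ?addr0 => [|i ik]; first by rewrite /e eqxx mul1r.
  by rewrite /e (negbTE ik) mul0r.
have := Bpsd (fun i => c i + s * e i).
have -> : \sum_i \sum_j (c i + s * e i) * (c j + s * e j) * B i j
  = \sum_i \sum_j c i * c j * B i j + 2 * s * b + s ^+ 2 * B k k.
  have -> : \sum_i \sum_j (c i + s * e i) * (c j + s * e j) * B i j
     = \sum_i (\sum_j c i * c j * B i j + s * (c i * B i k)
         + s * (e i * \sum_j c j * B i j) + s ^+ 2 * (e i * B i k)).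
    apply: eq_bigr => i _.
    rewrite -[in s * (c i * B i k)](ek (fun j => B i j)) -[in e i * B i k](ek (fun j => B i j)).
    rewrite !mulr_sumr -!big_split; apply: eq_bigr => j _ /=; ring.
  rewrite !big_split /= -!mulr_sumr !ek.
  have -> : \sum_j c j * B k j = b by apply: eq_bigr => j _; rewrite Bsym.
  rewrite -/b; ring.
rewrite c0 add0r /s.
have -> : 2 * (- b / B k k) * b + (- b / B k k) ^+ 2 * B k k = - (b ^+ 2 / B k k).
  by field; rewrite gt_eqF.
rewrite oppr_ge0 pmulr_lle0 ?invr_gt0 // => b2.
by apply/eqP; rewrite -sqrf_eq0 eq_le b2 sqr_ge0.
Qed.

Lemma sqr_sum_le (I : finType) (u : I -> R) :
  (\sum_i u i) ^+ 2 <= #|I|%:R * \sum_i u i ^+ 2.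
Proof.
have -> : #|I|%:R * \sum_i u i ^+ 2 = \sum_i \sum_j (u i ^+ 2 + u j ^+ 2) / 2.
  transitivity (\sum_i (#|I|%:R * u i ^+ 2 + \sum_j u j ^+ 2) / 2).
    rewrite -mulr_suml big_split /= -mulr_sumr sumr_const -mulr_natl.
    by field.
  apply: eq_bigr => i _; rewrite -mulr_suml big_split /= sumr_const.
  by rewrite mulr_natl.
rewrite expr2 mulr_suml; apply: ler_sum => i _.
rewrite mulr_sumr; apply: ler_sum => j _.
have := sqr_ge0 (u i - u j); rewrite sqrrB; lra.
Qed.
End QuadraticForms.

(** * The simplex as the positive orthant of a sphere *)

Section Simplex.
Variables (R : realType) (d : nat).
Implicit Types x y : 'rV[R]_d.

(** The point [(sqrt (1 - |x|), sqrt x_1, ..., sqrt x_d)] of the unit sphere of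
    dimension [d]; the distance of the simplex is the geodesic distance between
    such points. *)
Definition sphere_lift x (i : 'I_d.+1) : R :=
  if unlift ord0 i is Some j then Num.sqrt (x ord0 j)
  else Num.sqrt (1 - coord_sum x).

Definition sdot x y : R := \sum_i sphere_lift x i * sphere_lift y i.

Lemma simplex_distE x y : simplex_dist x y = acos (sdot x y).
Proof.
rewrite /simplex_dist /sdot big_ord_recl /sphere_lift unlift_none addrC.
by congr (acos (_ + _)); apply: eq_bigr => i _; rewrite liftK.
Qed.

Lemma sdotC x y : sdot x y = sdot y x.
Proof. by apply: eq_bigr => i _; rewrite mulrC. Qed.

Lemma sphere_lift_norm x : simplex x -> \sum_i sphere_lift x i ^+ 2 = 1.
Proof.
move=> [x0 x1]; rewrite big_ord_recl /sphere_lift unlift_none.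
rewrite sqr_sqrtr ?subr_ge0 //.
under eq_bigr => i _ do rewrite liftK sqr_sqrtr //.
by rewrite subrK.
Qed.

Lemma sdot_ge0 x y : 0 <= sdot x y.
Proof.
apply: sumr_ge0 => i _; rewrite /sphere_lift.
by case: unliftP => *; rewrite mulr_ge0 // sqrtr_ge0.
Qed.

Lemma sdotxx x : simplex x -> sdot x x = 1.
Proof.
by move=> /sphere_lift_norm <-; apply: eq_bigr => i _; rewrite expr2.
Qed.

(** The squared chord length; it shows both that [sdot] is at most [1] and that
    it is [1] only at equal points. *)
Lemma sdot_gap x y : simplex x -> simplex y ->
  \sum_i (sphere_lift x i - sphere_lift y i) ^+ 2 = 2 * (1 - sdot x y).
Proof.
move=> sx sy; under eq_bigr do rewrite sqrrB.
rewrite big_split sumrB /= sphere_lift_norm // sphere_lift_norm //.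
by rewrite sumrMnl -/(sdot x y) -mulr_natl; ring.
Qed.

Lemma sdot_le1 x y : simplex x -> simplex y -> sdot x y <= 1.
Proof.
move=> sx sy; rewrite -subr_ge0 -(pmulr_rge0 _ (@ltr0Sn R 1)) -sdot_gap //.
by apply: sumr_ge0 => i _; exact: sqr_ge0.
Qed.

Lemma sdot_lt1 x y : simplex x -> simplex y -> x != y -> sdot x y < 1.
Proof.
move=> sx sy xy; rewrite lt_neqAle sdot_le1 // andbT.
apply: contra xy => /eqP xy1; apply/eqP/rowP => j.
have /eqP := sdot_gap sx sy; rewrite xy1 subrr mulr0 psumr_eq0 => [|i _]; last exact: sqr_ge0.
move/allP => /(_ (lift ord0 j)); rewrite mem_index_enum => /(_ isT) /=.
rewrite sqrf_eq0 subr_eq0 /sphere_lift liftK => /eqP /(congr1 (fun z => z ^+ 2)).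
by rewrite !sqr_sqrtr //; [exact: sy.1|exact: sx.1].
Qed.

Lemma sdot_itv x y : simplex x -> simplex y -> sdot x y \in `[-1, 1].
Proof.
move=> sx sy; rewrite in_itv /= sdot_le1 // andbT.
by apply: le_trans (sdot_ge0 _ _); rewrite oppr_le0.
Qed.

Lemma dist_matrixE (f : R -> R) N (x : 'I_N -> 'rV[R]_d) i j :
  (forall i, simplex (x i)) ->
  dist_matrix (@simplex_dist R d) f x i j = f (sdot (x i) (x j)).
Proof. by move=> sx; rewrite mxE simplex_distE acosK // sdot_itv. Qed.

Lemma dist_matrix_sym (f : R -> R) N (x : 'I_N -> 'rV[R]_d) :
  (dist_matrix (@simplex_dist R d) f x)^T = dist_matrix (@simplex_dist R d) f x.
Proof. by apply/matrixP => i j; rewrite !mxE !simplex_distE sdotC. Qed.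
End Simplex.

(** * Gegenbauer expansions on the simplex *)

Section Expansion.
Variables (R : realType) (k : nat) (f : R -> R) (a : nat -> R).
Let l : R := (k.+2%:R - 1) / 2.
Hypothesis a_ge0 : forall n, 0 <= a n.*2.
Hypothesis f_expansion : even_gegenbauer_expansion l a f.
Local Notation G := (gegpoly l).
Local Notation S := (@simplex R k.+2).

Let lk : 2 * l = k.+1%:R.
Proof. by rewrite /l mulrC divfK ?pnatr_eq0 // -natr1 addrK. Qed.

Let l0 : 0 < l.
Proof. by have : 0 < 2 * l by [rewrite lk ltr0n]; rewrite pmulr_rgt0. Qed.

Definition partial_poly N : {poly R} := \sum_(0 <= n < N) a n.*2 *: G n.*2.

(** Uniform convergence in the angle is uniform convergence in its cosine, since
    every [t] in the interval [`[-1, 1]] is the cosine of [acos t]. *)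
Lemma expansion_near (E : set (R * R)) : entourage E ->
  \forall N \near \oo, forall t, t \in `[-1, 1] -> E (f t, (partial_poly N).[t]).
Proof.
move=> entE; have [_ cvg_f] := f_expansion.
have nb : nbhs ((f \o cos) : {uniform` `[0, pi]%classic -> R})
    [set h | forall y, `[0, pi]%classic y -> E (f (cos y), h y)].
  by apply/uniform_nbhs; exists E; split.
have H := cvg_f _ nb.
near=> N => t t11.
have EN : forall y, `[0, pi]%classic y -> E (f (cos y), \sum_(0 <= n < N) a n.*2 *
  (gegenbauer l n.*2).[cos y]).
  by near: N; exact: H.
have [/andP[p0 p1] ct] := acos_def t11.
have := EN (acos t); rewrite /= in_itv /= p0 p1 ct => /(_ isT).
suff -> : (partial_poly N).[t] = \sum_(0 <= n < N) a n.*2 * (gegenbauer l n.*2).[t].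
  by [].
rewrite /partial_poly horner_sum; apply: eq_bigr => n _.
by rewrite hornerZ (gegenbauerE lk).
Unshelve. all: by end_near. Qed.

Lemma expansion_cvg t : t \in `[-1, 1] ->
  (fun N => (partial_poly N).[t]) @ \oo --> f t.
Proof.
move=> t11; apply/cvg_entourageP => E entE.
by apply: filterS (expansion_near entE) => N; exact.
Qed.

Lemma expansion_continuous : {within `[-1, 1]%classic, continuous f}.
Proof.
apply: (@uniform_limit_continuous_subspace R R _
  ((fun N => horner (partial_poly N)) @ \oo)).
  change (\forall N \near \oo, continuous
    (horner (partial_poly N) : subspace `[-1, 1]%classic -> R)).
  apply: nearW => N; apply: continuous_subspaceT; exact: continuous_horner.
move=> P /uniform_nbhs [E [entE EP]].
by apply: filterS (expansion_near entE) => N EN; apply: EP => t tI; exact: EN.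
Qed.

Section Points.
Variables (N : nat) (x : 'I_N -> 'rV[R]_k.+2).
Hypothesis xS : forall i, S (x i).
Local Notation A := (dist_matrix (@simplex_dist R k.+2) f x).

Definition gquad n (c : 'I_N -> R) : R :=
  \sum_i \sum_j c i * c j * (G n).[sdot (x i) (x j)].

(** The lifted points lie in dimension [k.+3], which is [2 * l + 2]. *)
Lemma gquad_ge0 n c : 0 <= gquad n c.
Proof.
have -> : gquad n c = \sum_i \sum_j c i * c j * geg_rec l idfun
    (\sum_q sphere_lift (x i) q * sphere_lift (x j) q) 1 n.
  by apply: eq_bigr => i _; apply: eq_bigr => j _; rewrite horner_gegpoly.
apply: SphericalHarmonics.geg_rec_posdef => // [|i].
  by rewrite lk -natrD addn2.
exact: sphere_lift_norm.
Qed.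

Lemma quad_cvg (c : 'rV[R]_N) :
  (fun M => \sum_(0 <= n < M) a n.*2 * gquad n.*2 (c ord0)) @ \oo
    --> (c *m A *m c^T) ord0 ord0.
Proof.
rewrite quad_formE.
have -> : (fun M => \sum_(0 <= n < M) a n.*2 * gquad n.*2 (c ord0))
  = (fun M => \sum_i \sum_j c ord0 i * c ord0 j * (partial_poly M).[sdot (x i) (x j)]).
  apply/funext => M; rewrite /gquad.
  under eq_bigr do rewrite mulr_sumr.
  rewrite exchange_big; apply: eq_bigr => i _ /=.
  under eq_bigr do rewrite mulr_sumr.
  rewrite exchange_big; apply: eq_bigr => j _ /=.
  rewrite horner_sum mulr_sumr; apply: eq_bigr => n _.
  by rewrite hornerZ; ring.
apply: cvg_big => [|i _]; first exact: add_continuous.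
apply: cvg_big => [|j _]; first exact: add_continuous.
rewrite dist_matrixE //; apply: cvgM; first exact: cvg_cst.
by apply: expansion_cvg; exact: sdot_itv.
Qed.

Lemma quad_ge_partial (c : 'rV[R]_N) M :
  \sum_(0 <= n < M) a n.*2 * gquad n.*2 (c ord0) <= (c *m A *m c^T) ord0 ord0.
Proof.
set u := fun M => \sum_(0 <= n < M) a n.*2 * gquad n.*2 (c ord0).
have cu := @quad_cvg c; rewrite -/u in cu.
rewrite -[X in _ <= X](cvg_lim _ cu) //.
apply: (@nondecreasing_cvgn_le R u) => [m n mn|]; last by apply: cvgP cu.
rewrite /u (big_cat_nat _ mn) //= lerDl; apply: sumr_ge0 => i _.
by rewrite mulr_ge0 // gquad_ge0.
Qed.

Lemma quad_ge0 (c : 'rV[R]_N) : 0 <= (c *m A *m c^T) ord0 ord0.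
Proof. by have := quad_ge_partial c 0; rewrite big_nil. Qed.

Lemma gquad_eq0 (c : 'rV[R]_N) n : (c *m A *m c^T) ord0 ord0 <= 0 ->
  0 < a n.*2 -> gquad n.*2 (c ord0) = 0.
Proof.
move=> q0 an; apply/eqP; rewrite eq_le gquad_ge0 andbT.
have := le_trans (quad_ge_partial c n.+1) q0.
rewrite big_nat_recr //= => h.
rewrite -(pmulr_rle0 _ an); apply: le_trans h; rewrite lerDr.
by apply: sumr_ge0 => m _; rewrite mulr_ge0 // gquad_ge0.
Qed.

End Points.

(** The kernel of the form gives the linear relation
    [c q * G 1 = - \sum_(i != q) c i * G (sdot (x i) (x q))], [G] of degree
    [n.*2]. Points of the simplex lift to one orthant, so the scalar products
    lie in the half-open interval from [0] to [1]: no two lifted points are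
    antipodal and the decay estimate applies to every term on the right. *)
Lemma gquad_null_bound N (x : 'I_N -> 'rV[R]_k.+2) (c : 'I_N -> R) q n :
  (forall i, S (x i)) -> injective x -> gquad x n.*2 c = 0 ->
  n.*2.+1%:R * c q ^+ 2 <=
  N%:R * \sum_(i | i != q) c i ^+ 2 / (1 - sdot (x i) (x q) ^+ 2) ^+ k.+1.
Proof.
move=> xS xI c0.
have g1 := gegpoly_at1_gt0 l0 n.*2.
have null : \sum_i c i * (G n.*2).[sdot (x i) (x q)] = 0.
  apply: (@psd_null_row R _ (fun i j => (G n.*2).[sdot (x i) (x j)])) => //.
  - by move=> i j; rewrite sdotC.
  - by move=> e; exact: gquad_ge0.
  - by rewrite sdotxx.
(* The diagonal term is set aside, being the only one that does not decay. *)
pose u i := if i == q then 0 else c i * (G n.*2).[sdot (x i) (x q)].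
have cq : c q * (G n.*2).[1] = - \sum_i u i.
  apply/eqP; rewrite -addr_eq0 -[X in _ == X]null; apply/eqP.
  rewrite [RHS](bigD1 q) //= sdotxx // (bigD1 q) //= {1}/u eqxx add0r.
  by congr (_ + _); apply: eq_bigr => i iq; rewrite /u (negbTE iq).
have w0 i : i != q -> 0 < 1 - sdot (x i) (x q) ^+ 2.
  move=> iq; rewrite subr_gt0 expr_lt1 ?sdot_ge0 // sdot_lt1 //.
  by apply: contra iq => /eqP /xI ->.
rewrite -(ler_pM2r (exprn_gt0 2 g1)) -mulrA -exprMn cq sqrrN.
apply: le_trans (ler_wpM2l (ler0n _ _) (sqr_sum_le u)) _.
rewrite card_ord mulrCA -[in leRHS]mulrA; apply: ler_wpM2l => //.
rewrite (bigD1 q) //= {1}/u eqxx expr0n add0r mulr_sumr mulr_suml.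
apply: ler_sum => i iq; rewrite /u (negbTE iq) exprMn.
rewrite [leRHS]mulrAC ler_pdivlMr ?exprn_gt0 ?w0 //.
have t01 : 0 <= sdot (x i) (x q) <= 1 by rewrite sdot_ge0 sdot_le1.
have := ler_wpM2l (sqr_ge0 (c i)) (gegpoly_even_decay lk n t01).
by congr (_ <= _); ring.
Qed.

Lemma infinite_unbounded (P : set nat) M : infinite_set P ->
  exists2 n, P n & (M <= n)%N.
Proof.
move=> Pinf; apply: contrapT => h; apply: Pinf.
apply: (@sub_finite_set _ _ `I_M) => [n Pn|]; last exact: finite_II.
by rewrite /= ltnNge; apply/negP => Mn; apply: h; exists n.
Qed.

(** Along the infinitely many degrees with positive coefficient the previous
    bound holds with the same right side, while its left side grows with [n]
    unless [c q] is zero. *)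
Lemma expansion_strict N (x : 'I_N -> 'rV[R]_k.+2) (c : 'rV[R]_N) :
  (forall i, S (x i)) -> injective x -> infinite_set [set n | 0 < a n.*2] ->
  c != 0 ->
  0 < (c *m dist_matrix (@simplex_dist R k.+2) f x *m c^T) ord0 ord0.
Proof.
move=> xS xI inf c0; rewrite ltNge; apply: contra c0 => q0.
apply/eqP/rowP => q; rewrite mxE; apply/eqP; apply: contraT => cq.
have cq0 : 0 < c ord0 q ^+ 2 by rewrite exprn_even_gt0.
set K := N%:R * \sum_(i | i != q)
  c ord0 i ^+ 2 / (1 - sdot (x i) (x q) ^+ 2) ^+ k.+1.
(* A degree so large that the bound on [c q] fails. *)
have [n an Mn] := infinite_unbounded (Num.truncn (K / c ord0 q ^+ 2)).+1 inf.
have Kn := gquad_null_bound q xS xI (gquad_eq0 xS q0 an).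
have : n%:R < n.*2.+1%:R :> R by rewrite ltr_nat; lia.
move/lt_le_trans => /(_ (K / c ord0 q ^+ 2)); rewrite ler_pdivlMr // => /(_ Kn).
rewrite ltNge => /negP; case; apply: ltW.
apply: lt_le_trans (truncnS_gt _) _; by rewrite ler_nat.
Qed.

(** Points [i / N] on the edge of the first coordinate; they lift to a great
    circle, where the kernel is a polynomial in the two coordinates of each
    argument. *)
Definition edge_point (N : nat) (i : 'I_N) : 'rV[R]_k.+2 :=
  \row_j (if j == ord0 then i%:R / N%:R else 0).

Lemma coord_sum_edge N (i : 'I_N) : coord_sum (edge_point i) = i%:R / N%:R.
Proof.
rewrite /coord_sum (bigD1 ord0) //= mxE eqxx big1 ?addr0 // => j j0.
by rewrite mxE (negbTE j0).
Qed.

Lemma edge_simplex N (i : 'I_N) : S (edge_point i).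
Proof.
have N0 : 0 < N%:R :> R by rewrite ltr0n; case: i => [[|?]] //=; lia.
split=> [j|]; last by rewrite coord_sum_edge ler_pdivrMr // mul1r ler_nat ltnW.
by rewrite mxE; case: ifP => // _; rewrite divr_ge0.
Qed.

Lemma edge_inj N : injective (@edge_point N).
Proof.
move=> i j /rowP /(_ ord0); rewrite !mxE eqxx => /eqP.
have N0 : N%:R != 0 :> R by rewrite pnatr_eq0; case: i => [[|?]] //=; lia.
by rewrite -subr_eq0 -mulrBl mulf_eq0 invr_eq0 (negbTE N0) orbF subr_eq0 eqr_nat
  => /eqP /val_inj.
Qed.

Definition edge_u N (i : 'I_N) : R := Num.sqrt (i%:R / N%:R).
Definition edge_v N (i : 'I_N) : R := Num.sqrt (1 - i%:R / N%:R).

Lemma sdot_edge N (i j : 'I_N) :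
  sdot (edge_point i) (edge_point j) = edge_u i * edge_u j + edge_v i * edge_v j.
Proof.
rewrite /sdot big_ord_recl /sphere_lift unlift_none !coord_sum_edge addrC.
rewrite (bigD1 ord0) //= liftK !mxE eqxx big1 ?addr0 // => q q0.
by rewrite liftK mxE (negbTE q0) sqrtr0 mul0r.
Qed.

(** Expand the kernel in monomials [u_i ^+ p * v_i ^+ q] and the same in [j],
    with [p] and [q] less than the size of [P]. When there are more points than
    such pairs of exponents, some nonzero [c] is orthogonal to all these
    monomials. *)
Lemma finite_rank_kernel (P : {poly R}) : exists N (c : 'rV[R]_N), c != 0 /\
  \sum_i \sum_j c ord0 i * c ord0 j
     * P.[edge_u i * edge_u j + edge_v i * edge_v j] = 0.
Proof.
pose s := size P; pose T : finType := ('I_s * 'I_s)%type.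
(* One point more than there are exponent pairs, so that the moment matrix
   [B] has a nonzero left kernel. *)
pose N := #|{: T}|.+1.
pose B := \matrix_(i < N, q < #|{: T}|)
  (edge_u i ^+ (enum_val q : T).1 * edge_v i ^+ (enum_val q : T).2).
have : kermx B != 0.
  rewrite kermx_eq0; apply/negP => /eqP rB.
  by have := rank_leq_col B; rewrite rB ltnn.
case/rowV0Pn => c /sub_kermxP cB c0; exists N, c; split=> //.
have moment p q : (p < s)%N -> (q < s)%N ->
    \sum_i c ord0 i * (edge_u i ^+ p * edge_v i ^+ q) = 0.
  move=> ps qs; have := congr1 (fun M : 'rV_ _ =>
    M ord0 (enum_rank ((Ordinal ps, Ordinal qs) : T))) cB.
  rewrite !mxE => h; rewrite -[RHS]h; apply: eq_bigr => i _.
  by rewrite mxE enum_rankK.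
transitivity (\sum_(m < s) \sum_(r < m.+1) P`_m * 'C(m, r)%:R *
   (\sum_i c ord0 i * (edge_u i ^+ (m - r) * edge_v i ^+ r)) ^+ 2); last first.
  apply: big1 => m _; apply: big1 => r _; rewrite moment ?expr0n ?mulr0 //.
    by apply: leq_ltn_trans (leq_subr _ _) _.
  by have := ltn_ord r; have := ltn_ord m; lia.
have sqr_sum (F : 'I_N -> R) : (\sum_i F i) ^+ 2 = \sum_i \sum_j F i * F j.
  by rewrite expr2 mulr_suml; apply: eq_bigr => i _; rewrite mulr_sumr.
under [RHS]eq_bigr do under eq_bigr do rewrite sqr_sum mulr_sumr.
under [RHS]eq_bigr do rewrite exchange_big /=.
rewrite [RHS]exchange_big; apply: eq_bigr => i _ /=.
under [RHS]eq_bigr do under eq_bigr do rewrite mulr_sumr.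
under [RHS]eq_bigr do rewrite exchange_big /=.
rewrite [RHS]exchange_big; apply: eq_bigr => j _ /=.
rewrite horner_coef mulr_sumr; apply: eq_bigr => m _.
rewrite exprDn !mulr_sumr; apply: eq_bigr => r _.
by rewrite -mulr_natl !exprMn; ring.
Qed.

(** With finitely many positive coefficients [f] is a polynomial on the interval
    [`[-1, 1]], and kernels of fixed polynomials are degenerate on large sets of
    points. *)
Lemma finite_not_strict : finite_set [set n | 0 < a n.*2] ->
  ~ SPhi S (@simplex_dist R k.+2) f.
Proof.
move=> fin [_ spd].
have [M aM] : exists M, forall n, (M <= n)%N -> a n.*2 = 0.
  have [M PM] : exists M, forall n, 0 < a n.*2 -> (n < M)%N.
    have [s sE] := (finite_seqP _).1 fin.
    exists (\max_(i <- s) i).+1 => n an; rewrite ltnS.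
    apply: (@leq_bigmax_seq _ s xpredT id n) => //.
    by have : [set n | 0 < a n.*2] n := an; rewrite sE.
  exists M => n Mn; apply/eqP; rewrite eq_le a_ge0 andbT leNgt.
  by apply/negP => /PM; rewrite ltnNge Mn.
have fP t : t \in `[-1, 1] -> f t = (partial_poly M).[t].
  move=> t11; have cf := expansion_cvg t11.
  rewrite -(cvg_lim _ cf) //; apply: (@lim_near_cst R) => //.
  near=> N; have MN : (M <= N)%N by near: N; exact: nbhs_infty_ge.
  rewrite {1}/partial_poly (big_cat_nat _ MN) //=.
  suff -> : \sum_(M <= n < N) a n.*2 *: gegpoly l n.*2 = 0 by rewrite addr0.
  by rewrite big_nat big1 // => n /andP[Mn _]; rewrite aM // scale0r.
have [N [c [c0 cK]]] := finite_rank_kernel (partial_poly M).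
have [_ /(_ c c0)] := spd N (@edge_point N) (@edge_inj N) (@edge_simplex N).
rewrite quad_formE => /lt_eqF/negP; case; apply/eqP.
rewrite -[LHS]cK; apply: eq_bigr => i _; apply: eq_bigr => j _.
rewrite dist_matrixE; last exact: edge_simplex.
by rewrite fP ?sdot_edge // -sdot_edge sdot_itv //; exact: edge_simplex.
Unshelve. all: by end_near. Qed.
End Expansion.

Theorem theorem4p6 (R : realType) (d : nat) (f : R -> R) (a : nat -> R)
    (d_ge2 : (2 <= d)%N)
    (f_even : forall t, t \in `[-1, 1] -> f (- t) = f t)
    (a_ge0 : forall n, 0 <= a n.*2)
    (f_expansion : even_gegenbauer_expansion ((d%:R - 1) / 2) a f) :
  Phi (@simplex R d) (@simplex_dist R d) f /\
  (SPhi (@simplex R d) (@simplex_dist R d) f <->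
     infinite_set [set n | 0 < a n.*2]).
Proof.
case: d d_ge2 f_expansion => [|[|k]] // _ f_expansion; split.
  split; first exact: (expansion_continuous f_expansion).
  move=> N x _ xS; split; first exact: dist_matrix_sym.
  by move=> c; exact: (quad_ge0 a_ge0 f_expansion).
split=> [spd fin|inf]; first exact: (finite_not_strict a_ge0 f_expansion fin spd).
split; first exact: (expansion_continuous f_expansion).
move=> N x xI xS; split; first exact: dist_matrix_sym.
by move=> c; exact: (expansion_strict a_ge0 f_expansion).
Qed.
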